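(* Let $M\ge3$, $2<K<\frac{M}{2}$, and let $\mathcal{S}_K$ be the collection of all subsets of $\{1,\dots,M\}$ of size exactly $K$. Consider the outlier hypothesis testing problem with $K$ (known number) possibly distinctly distributed outliers described in the context, in the setting where only $\pi$ is known (the $\mu_i$ are unknown). For each threshold $T$, let $(N^*,\delta^* )$ be the test with parameter $T$ described in the context, and let $P_{\max}$ be its maximal error probability. Then this test is universally exponentially consistent, and for all full-support $\mu_1,\dots,\mu_M,\pi\in\mathcal{P}(\mathcal{Y})$ with $\mu_i\ne\pi$ for every $i$ it satisfies, for every $T$, $$P_{\max}\le\frac{C}{T},$$ where $C$ is a constant that depends only on $M,K,(\mu_i)_i,\pi$, but not on $T$. In addition, for each hypothesis $S\in\mathcal{S}_K$, as $T\to\infty$, $$\mathbb{E}_S[N^*]\le\frac{-\log P_{\max}}{\min_{i\in S}D(\mu_i\|\pi)}(1+o(1)).$$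
   Context: All logarithms are natural. $\mathcal{Y}$ is a finite known set, $\mathcal{P}(\mathcal{Y})$ is the set of probability distributions on $\mathcal{Y}$, and $D(p\|q)=\sum_{y\in\mathcal{Y}}p(y)\log\frac{p(y)}{q(y)}$ is relative entropy. Model. There are $M\ge3$ independent sequences of observations; $Y^{(i)}_k\in\mathcal{Y}$ is the $k$-th observation of the $i$-th sequence, and each sequence is i.i.d. Exactly $K$ of the sequences are outliers, $2<K<M/2$. Let $\pi$ and $\mu_1,\dots,\mu_M$ be full-support distributions on $\mathcal{Y}$ with $\mu_i\ne\pi$ for each $i$ (otherwise arbitrary, and the $\mu_i$ may be arbitrarily distinct from one another). Under the hypothesis $S\in\mathcal{S}_K$ ($S$ is the set of outliers), the first $n$ observations $\mathbf{y}^n$ of all sequences have joint law $$p_S(\mathbf{y}^n)=\prod_{k=1}^n\Big\{\prod_{i\in S}\mu_i(y^{(i)}_k)\prod_{j\notin S}\pi(y^{(j)}_k)\Big\}.$$ There is no null hypothesis. $\mathbb{P}_S,\mathbb{E}_S$ denote probability and expectation under hypothesis $S$. A sequential test is a pair $(N,\delta)$ of a stopping time $N$ and a decision rule $\delta$ which, on $N=n$, maps the first $n$ observations of all sequences to an element of $\mathcal{S}_K$. Its maximal error probability is $P_{\max}=\max_{S\in\mathcal{S}_K}\mathbb{P}_S\{\delta(\mathbf{Y}^N)\ne S\}$. A family of tests indexed by $T$ is universally exponentially consistent if, for all admissible $(\mu_i)_i,\pi$, $P_{\max}\to 0$ as $T\to\infty$ and for each $S\in\mathcal{S}_K$ there is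 $\alpha_S>0$ such that $\mathbb{E}_S[N]\le\frac{-\log P_{\max}}{\alpha_S}(1+o(1))$ as $P_{\max}\to0$. The test. At time $n$ let $\gamma_i$ be the empirical distribution of the first $n$ observations of sequence $i$. For $S\in\mathcal{S}_K$ put $G_n(S)=\sum_{j\notin S}D(\gamma_j\|\pi)$ and let $\hat S=\hat S(\mathbf{Y}^n)\in\operatorname{argmin}_{S\in\mathcal{S}_K}G_n(S)$. Then $N^*$ is the smallest $n\ge1$ such that $$\min_{S'\in\mathcal{S}_K,\,S'\ne\hat S}\ n\big[G_n(S')-G_n(\hat S)\big]>\log T+(M+1)|\mathcal{Y}|\log(n+1),$$ and $\delta^*=\hat S(\mathbf{Y}^{N^*})$. *)

(* Defs.v *)
From HB Require Import structures.
From mathcomp Require Import all_boot all_order all_algebra.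
From mathcomp Require Import all_classical all_reals all_analysis.

Set Implicit Arguments.
Unset Strict Implicit.
Unset Printing Implicit Defensive.

Import Order.TTheory GRing.Theory Num.Theory.
Import numFieldNormedType.Exports.

Local Open Scope classical_set_scope.
Local Open Scope ring_scope.

Record dist (R : realType) (Y : finType) := Dist {
  pmf :> {ffun Y -> R};
  pmfP : [forall y, 0 <= pmf y] && (\sum_y pmf y == 1) }.

HB.instance Definition _ (R : realType) (Y : finType) :=
  [isSub for @pmf R Y].
HB.instance Definition _ (R : realType) (Y : finType) :=
  [Equality of dist R Y by <:].

Definition full_support (R : realType) (Y : finType) (p : dist R Y) : Prop :=
  forall y, 0 < p y.

(* The terms with p y = 0 vanish, as usual; the value is only meaningful when
   q y = 0 implies p y = 0 (here q always has full support).  The arguments are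
   plain functions because the empirical distribution of zero observations is
   not a probability distribution. *)
Definition relent (R : realType) (Y : finType) (p q : Y -> R) : R :=
  \sum_y p y * ln (p y / q y).

Notation hyp M K := {S : {set 'I_M} | #|S| == K}.

Definition admissible (R : realType) (Y : finType) (M : nat)
    (pi : dist R Y) (mu : 'I_M -> dist R Y) : Prop :=
  [/\ full_support pi, forall i, full_support (mu i) & forall i, mu i != pi].

(* The first n observations of the M sequences are stored in an n x M matrix:
   y k i is the k-th observation (counted from 0) of the i-th sequence. *)
Definition joint_law (R : realType) (Y : finType) (M K : nat)
    (pi : dist R Y) (mu : 'I_M -> dist R Y) (S : hyp M K)
    (n : nat) (y : 'M[Y]_(n, M)) : R :=
  \prod_(k < n) ((\prod_(i in val S) mu i (y k i)) *
                 \prod_(j | j \notin val S) pi (y k j)).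

Definition sample (Y : finType) (M : nat) (Omega : Type)
    (obs : 'I_M -> nat -> Omega -> Y) (n : nat) (w : Omega) : 'M[Y]_(n, M) :=
  \matrix_(k < n, i < M) obs i k w.

(* Any realization of the observation process (one exists by Kolmogorov's
   extension theorem): the probabilities of all the
   cylinders are prescribed, so by uniqueness of the extension error
   probabilities and expected stopping times do not depend on it. *)
Record obs_model (R : realType) (Y : finType) (M K : nat)
    (pi : dist R Y) (mu : 'I_M -> dist R Y) := ObsModel {
  disp : measure_display;
  Omega : measurableType disp;
  obs : 'I_M -> nat -> Omega -> Y;
  PS : hyp M K -> probability Omega R;
  obs_measurable : forall i k y, measurable [set w | obs i k w = y];
  obs_law : forall (S : hyp M K) (n : nat) (y : 'M[Y]_(n, M)),
    PS S [set w | sample obs n w = y] = (joint_law pi mu S y)%:E }.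

Arguments obs {R Y M K pi mu} _ _ _ _.

(* The stopping time is the first n such that stops holds of the first n
   observations; every stopping time of the observation filtration is of this
   form. *)
Record seq_test (Y : finType) (M K : nat) := SeqTest {
  stops : forall n, 'M[Y]_(n, M) -> bool;
  decide : forall n, 'M[Y]_(n, M) -> hyp M K }.

Section performance.
Variables (R : realType) (Y : finType) (M K : nat).
Variables (pi : dist R Y) (mu : 'I_M -> dist R Y) (m : obs_model K pi mu).
Variable t : seq_test Y M K.

(* +oo when the test never stops, since ereal_inf set0 = +oo. *)
Definition stop_time (w : Omega m) : \bar R :=
  ereal_inf [set (n%:R)%:E | n in
    [set n | is_true (stops t (sample (obs m) n w))]].

(* Never stopping counts as an error. *)
Definition error_event (S : hyp M K) : set (Omega m) :=
  ~` [set w | exists2 n, stop_time w = (n%:R)%:E &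
                decide t (sample (obs m) n w) = S].

Definition Pmax : \bar R :=
  \big[maxe/0%E]_(S : hyp M K) PS m S (error_event S).

Definition expected_time (S : hyp M K) : \bar R :=
  (\int[PS m S]_w stop_time w)%E.

End performance.

(* a <= b (1 + o(1)) along the filter F *)
Definition asymp_le (R : realType) (F : set_system R) (a b : R -> \bar R) :
    Prop :=
  exists r : R -> R, r x @[x --> F] --> (0 : R) /\
    \forall x \near F, (a x <= b x * (1 + r x)%:E)%E.

(* For a family of tests indexed by T > 0 with maximal error probability
   perr T: the filter of the limit "as perr T tends to 0". *)
Definition err_to0 (R : realType) (perr : R -> \bar R) : set_system R :=
  filter_from [set e : R | 0 < e] (fun e => [set T | 0 < T /\ (perr T < e%:E)%E]).

(* The family of tests may depend on pi, which is known, but not on mu.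
   lne 0 = -oo, so that - lne 0 = +oo. *)
Definition univ_exp_consistent (R : realType) (Y : finType) (M K : nat)
    (t : dist R Y -> R -> seq_test Y M K) : Prop :=
  forall (pi : dist R Y) (mu : 'I_M -> dist R Y), admissible pi mu ->
  forall m : obs_model K pi mu,
  let perr T := Pmax m (t pi T) in
  perr T @[T --> +oo] --> 0%E /\
  forall S : hyp M K, exists2 alpha : R, 0 < alpha &
    asymp_le (err_to0 perr)
      (fun T => expected_time m (t pi T) S)
      (fun T => (- lne (perr T) / alpha%:E)%E).

Section test.
Variables (R : realType) (Y : finType) (M K : nat).

Definition empirical n (y : 'M[Y]_(n, M)) (i : 'I_M) (a : Y) : R :=
  #|[pred k : 'I_n | y k i == a]|%:R / n%:R.

Definition Gstat (pi : dist R Y) n (y : 'M[Y]_(n, M)) (S : hyp M K) : R :=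
  \sum_(j | j \notin val S) relent (empirical y j) pi.

Definition argmin_rule
    (Shat : dist R Y -> forall n, 'M[Y]_(n, M) -> hyp M K) : Prop :=
  forall pi, full_support pi -> forall n (y : 'M[Y]_(n, M)) S,
    Gstat pi y (Shat pi n y) <= Gstat pi y S.

Definition threshold (T : R) (n : nat) : R :=
  ln T + ((M + 1) * #|Y|)%N%:R * ln (n + 1)%N%:R.

Definition outlier_test
    (Shat : dist R Y -> forall n, 'M[Y]_(n, M) -> hyp M K)
    (pi : dist R Y) (T : R) : seq_test Y M K :=
  SeqTest
    (fun n (y : 'M[Y]_(n, M)) => (0 < n)%N &&
       ((threshold T n)%:E <
          \big[mine/+oo]_(S' : hyp M K | S' != Shat pi n y)
            (n%:R * (Gstat pi y S' - Gstat pi y (Shat pi n y)))%:E)%E)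
    (Shat pi).

End test.

Definition min_relent (R : realType) (Y : finType) (M K : nat)
    (pi : dist R Y) (mu : 'I_M -> dist R Y) (S : hyp M K) : \bar R :=
  (\big[mine/+oo]_(i in val S) (relent (mu i) pi)%:E)%E.

(* Main.v *)
Require Import Defs.
From HB Require Import structures.
From mathcomp Require Import all_boot all_order all_algebra.
From mathcomp Require Import all_classical all_reals all_analysis.
From mathcomp Require Import zify ring lra.

(** Fix a hypothesis [S] and let p_i be the true law of the i-th sequence:
    [mu i] for i in S and [pi] otherwise.  Everything rests on one large
    deviation bound, for the divergence
      V_n = sum_i D(gamma_i || p_i)
    of the empirical distributions from the true laws.  Since exp (n V_n) is
    the likelihood ratio between the maximum likelihood fit and the true law,
    and since there are at most (n+1)^(M|Y|) vectors of empirical distributions,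
    E_S[exp (n V_n)] <= (n+1)^(M|Y|), whence by Markov's inequality
      P_S(n V_n >= l) <= (n+1)^(M|Y|) exp(-l)
    ([sum_max_likelihood], [divergence_tail], [probability_divergence]).

    Error probability.  G_n is nonnegative and G_n(S) <= V_n, so that stopping
    at time n with a decision different from S forces n V_n to exceed the
    threshold log T + (M+1)|Y| log(n+1).  This has probability at most
    (n+1)^(-|Y|) / T <= (1/n - 1/(n+1)) / T, as |Y| >= 2, and the sum over n
    telescopes: the error probability is at most 1/T
    ([probability_error_outlier]).

    Expected stopping time.  Let D be the minimum of D(mu_i || pi) over i in S.
    If V_n is small, then G_n(S) is small, while for S' <> S the complement of
    S' contains an outlier, so that G_n(S') is nearly at least D
    ([Gstat_gap]); this uses that D(gamma || pi) >= D(mu || pi) - e as soon as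
    D(gamma || mu) is small ([relent_lsc]).  The test then stops at every n
    with threshold below n (D - e), that is, up to a constant, for
    n >= log T / (D - 2e).  As N is at most the number of times at which the
    stopping condition fails ([expected_time_le]) and the large deviation
    probabilities are summable, E_S[N] <= (1 + e) log T / D + C_e for T >= 1
    ([expected_time_outlier_le]).  Since log T <= - log Pmax, both asymptotic
    statements follow ([asymp_expected_time]). *)

Set Implicit Arguments.
Unset Strict Implicit.
Unset Printing Implicit Defensive.

Import Order.TTheory GRing.Theory Num.Theory.
Import numFieldNormedType.Exports.

Local Open Scope classical_set_scope.
Local Open Scope ring_scope.

(** * Relative entropy *)

Lemma relent_term_ge (R : realType) (a b : R) :
  0 <= a -> 0 < b -> a - b <= a * ln (a / b) ?= iff (a == b).
Proof.
move=> a0 b0; have [->|an0] := eqVneq a 0.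
  by rewrite mul0r sub0r; split; lra.
have a1 : 0 < a by rewrite lt_def an0 a0.
have t0 : 0 < b / a by rewrite divr_gt0.
have -> : ln (a / b) = - ln (b / a) by rewrite -lnV ?invf_div ?posrE.
set x := ln (b / a); have bE : b = a * expR x.
  by rewrite /x lnK ?posrE// mulrCA divff ?mulr1.
have [x0|xn0] := eqVneq x 0; first by rewrite bE x0 expR0; split; lra.
have h : a * (1 + x) < a * expR x by rewrite ltr_pM2l// expR_gt1Dx.
have -> : (a == b) = false.
  apply/negP => /eqP ab; move: xn0; rewrite /x -ab divff// ln1.
  by rewrite eqxx.
by rewrite bE; split; nra.
Qed.

(** Gibbs' inequality, without normalization of either argument. *)
Lemma relent_ge (R : realType) (Y : finType) (p q : Y -> R) :
  (forall y, 0 <= p y) -> (forall y, 0 < q y) ->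
  \sum_y p y - \sum_y q y <= relent p q.
Proof.
by move=> p0 q0; rewrite -sumrB; apply: ler_sum => y _; exact: relent_term_ge.
Qed.

Lemma sum_dist (R : realType) (Y : finType) (p : dist R Y) : \sum_y p y = 1.
Proof. by case: p => p /= /andP[_ /eqP]. Qed.

Lemma dist_ge0 (R : realType) (Y : finType) (p : dist R Y) y : 0 <= p y.
Proof. by case: p => p /= /andP[/forallP/(_ y)]. Qed.

Lemma relent_gt0 (R : realType) (Y : finType) (p q : dist R Y) :
  full_support q -> p != q -> 0 < relent p q.
Proof.
move=> q0 pq.
have h : forall y, true -> p y - q y <= p y * ln (p y / q y) ?= iff (p y == q y).
  by move=> y _; apply: relent_term_ge => //; exact: dist_ge0.
have := leif_sum h; rewrite sumrB !sum_dist subrr -/(relent p q) => -[h0 h1].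
rewrite lt_def h0 eq_sym h1 andbT; apply: contra pq => /forallP pqE.
by apply/eqP/val_inj/ffunP => y; apply/eqP; exact: pqE.
Qed.

Lemma expR_le_quadratic (R : realType) (x : R) :
  x <= 1 / 2 -> expR x <= 1 + x + 2 * x ^+ 2.
Proof.
move=> x1; have h := expR_ge1Dx (- x).
have h2 := expR_gt0 (- x); have h3 := expR_gt0 x.
have h4 : expR x * expR (- x) = 1 by rewrite -expRD subrr expR0.
have h5 : expR x * (1 - x) <= 1 by rewrite -[leRHS]h4 ler_pM2l.
have h6 : 1 <= (1 + x + 2 * x ^+ 2) * (1 - x).
  have -> : (1 + x + 2 * x ^+ 2) * (1 - x) = 1 + x ^+ 2 * (1 - 2 * x) by ring.
  by rewrite lerDl mulr_ge0 ?sqr_ge0//; lra.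
have h7 : 0 < 1 - x by lra.
by rewrite -(ler_pM2r h7) (le_trans h5).
Qed.

(** Lower semicontinuity of [relent _ pi] at [mu], the distance to [mu] being
    measured by [relent _ mu].  The difference [relent g pi - relent g mu] is
    linear in [g]; Gibbs' inequality against the tilted weight
    [mu y * expR (s * f y)], for small s, bounds its variation. *)
Lemma relent_lsc (R : realType) (Y : finType) (mu pi : dist R Y) :
  full_support mu -> full_support pi ->
  forall e : R, 0 < e -> exists2 eta : R, 0 < eta &
    forall g : Y -> R, (forall y, 0 <= g y) -> \sum_y g y = 1 ->
      relent g mu <= eta -> relent mu pi - e <= relent g pi.
Proof.
move=> mu0 pi0 e e0; pose L y := ln (mu y / pi y).
(* f is centered under mu, and relent g pi - relent g mu is the mean of L
   under g *)
pose f y := relent mu pi - L y.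
have muf : \sum_y mu y * f y = 0.
  under eq_bigr do rewrite mulrBr.
  by rewrite sumrB -mulr_suml sum_dist mul1r subrr.
pose B := \sum_y `|f y|; pose V := \sum_y mu y * f y ^+ 2.
have B0 : 0 <= B by apply: sumr_ge0.
have V0 : 0 <= V by apply: sumr_ge0 => y _; rewrite mulr_ge0 ?sqr_ge0 ?dist_ge0.
have fB y : f y <= B.
  by rewrite (le_trans (ler_norm _))// /B (bigD1 y)//= lerDl sumr_ge0.
(* s is small enough for the quadratic bound on expR (s * f y), and for the
   second-order term 2 * s * V to be at most e / 2 *)
pose s : R := Num.min (1 / (2 * (B + 1))) (e / (4 * (V + 1))).
have s0 : 0 < s by rewrite lt_min !divr_gt0//; lra.
have sB : s * B <= 1 / 2.
  have : s <= 1 / (2 * (B + 1)) by rewrite ge_min lexx.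
  rewrite ler_pdivlMr; last lra.
  by move=> h; nra.
have sV : 2 * s * V <= e / 2.
  have : s <= e / (4 * (V + 1)) by rewrite ge_min lexx orbT.
  rewrite ler_pdivlMr; last lra.
  by move=> h; nra.
exists (s * (e / 2)) => [|g g0 g1 gmu]; first by rewrite mulr_gt0//; lra.
have gmu0 : 0 <= relent g pi - relent g mu - \sum_y g y * L y.
  rewrite /relent -!sumrB; apply: sumr_ge0 => y _.
  have [->|gy] := eqVneq (g y) 0; first by rewrite !mul0r !subrr.
  have gy0 : 0 < g y by rewrite lt_def gy g0.
  by rewrite /L !ln_div ?posrE//; lra.
have mu_ge0 : 0 <= relent g mu.
  by have := relent_ge g0 mu0; rewrite g1 sum_dist subrr.
(* Gibbs' inequality against the tilted weight *)
have tilt : relent g mu >= s * (\sum_y g y * f y) - 2 * s ^+ 2 * V.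
  have q0 y : 0 < mu y * expR (s * f y) by rewrite mulr_gt0 ?expR_gt0.
  have := relent_ge g0 q0; rewrite g1.
  have -> : relent g (fun y => mu y * expR (s * f y)) =
            relent g mu - s * (\sum_y g y * f y).
    rewrite /relent mulr_sumr -sumrB; apply: eq_bigr => y _.
    have [->|gy] := eqVneq (g y) 0; first by rewrite !mul0r mulr0 subrr.
    have gy0 : 0 < g y by rewrite lt_def gy g0.
    by rewrite !ln_div ?posrE// lnM ?posrE ?expR_gt0// expRK; ring.
  have : \sum_y mu y * expR (s * f y) <= 1 + 2 * s ^+ 2 * V.
    have -> : 1 + 2 * s ^+ 2 * V =
        \sum_y mu y * (1 + s * f y + 2 * (s * f y) ^+ 2).
      have E y : mu y * (1 + s * f y + 2 * (s * f y) ^+ 2) =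
          mu y + s * (mu y * f y) + 2 * s ^+ 2 * (mu y * f y ^+ 2) by ring.
      under eq_bigr do rewrite E.
      by rewrite !big_split/= sum_dist -!mulr_sumr muf mulr0 addr0.
    apply: ler_sum => y _; rewrite ler_wpM2l ?dist_ge0// expR_le_quadratic//.
    by rewrite (le_trans _ sB)// ler_pM2l.
  by move=> h1 h2; lra.
have fE : \sum_y g y * f y = relent mu pi - \sum_y g y * L y.
  under eq_bigr do rewrite mulrBr.
  by rewrite sumrB -mulr_suml g1 mul1r.
have h : s * (\sum_y g y * f y) <= s * e.
  have -> : s * e = s * (e / 2) + s * (e / 2) by field.
  have := ler_wpM2l (ltW s0) sV; rewrite expr2 in tilt; nra.
move: h; rewrite ler_pM2l// fE => h; lra.
Qed.

(** * The method of types *)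

Lemma sum_prod_mx (R : comPzSemiRingType) (Y : finType) (n M : nat)
    (F : 'I_n -> 'I_M -> Y -> R) :
  \sum_(y : 'M[Y]_(n, M)) \prod_k \prod_i F k i (y k i) =
  \prod_k \prod_i \sum_a F k i a.
Proof.
rewrite pair_bigA bigA_distr_bigA/=.
rewrite (reindex (fun f : {ffun 'I_n * 'I_M -> Y} => \matrix_(k, i) f (k, i)))/=.
  apply: eq_bigr => f _; rewrite pair_bigA/=.
  by apply: eq_bigr => -[k i] _ /=; rewrite mxE.
apply: onW_bij; exists (fun y : 'M[Y]_(n, M) => [ffun p => y p.1 p.2]).
  by move=> f; apply/ffunP => -[k i]; rewrite ffunE mxE.
by move=> y; apply/matrixP => k i; rewrite mxE ffunE.
Qed.

Section types.
Variables (R : realType) (Y : finType) (M : nat).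

Lemma empirical_ge0 n (y : 'M[Y]_(n, M)) i a : 0 <= empirical R y i a :> R.
Proof. by rewrite /empirical divr_ge0. Qed.

Lemma empirical_mean n (y : 'M[Y]_(n, M)) i (f : Y -> R) :
  n%:R * (\sum_a empirical R y i a * f a) = \sum_k f (y k i).
Proof.
case: n y => [|n] y; first by rewrite mul0r big_ord0.
rewrite (partition_big (fun k => y k i) xpredT)//= mulr_sumr.
apply: eq_bigr => a _; rewrite (eq_bigr (fun=> f a)); last by move=> k /eqP ->.
rewrite sumr_const /empirical -[in RHS]mulr_natl mulrA; congr (_ * _).
by rewrite mulrC divfK// pnatr_eq0.
Qed.

Lemma sum_empirical n (y : 'M[Y]_(n, M)) i :
  (0 < n)%N -> \sum_a empirical R y i a = 1 :> R.
Proof.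
move=> n0; have := empirical_mean y i (fun=> 1).
rewrite sumr_const card_ord -mulr_suml mulr1 => h.
by apply: (mulfI (x := n%:R)); rewrite ?mulr1// pnatr_eq0 -lt0n.
Qed.

Lemma relent_empirical_ge0 n (y : 'M[Y]_(n, M)) i (q : dist R Y) :
  full_support q -> 0 <= relent (empirical R y i) q.
Proof.
move=> q0; case: n y => [|n] y.
  rewrite /relent big1// => a _; rewrite /empirical.
  by rewrite (_ : _ / 0%:R = 0) ?mul0r// invr0 mulr0.
have := relent_ge (@empirical_ge0 _ y i) q0.
by rewrite sum_empirical// sum_dist subrr.
Qed.

(** The total divergence of the empirical distributions from the
    distributions [p i]. *)
Definition divergence (p : 'I_M -> dist R Y) n (y : 'M[Y]_(n, M)) : R :=
  \sum_i relent (empirical R y i) (p i).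

(** The likelihood ratio between the maximum likelihood fit and the law with
    marginals [p i] is the exponential of the divergence. *)
Lemma expR_divergence (p : 'I_M -> dist R Y) n (y : 'M[Y]_(n, M)) :
  (forall i, full_support (p i)) ->
  (\prod_k \prod_i p i (y k i)) * expR (n%:R * divergence p y) =
  \prod_k \prod_i empirical R y i (y k i).
Proof.
move=> p0.
have -> : n%:R * divergence p y =
    \sum_k \sum_i ln (empirical R y i (y k i) / p i (y k i)).
  rewrite /divergence mulr_sumr [RHS]exchange_big/=; apply: eq_bigr => i _.
  exact: (empirical_mean y i (fun a => ln (empirical R y i a / p i a))).
rewrite expR_sum -big_split/=; apply: eq_bigr => k _.
rewrite expR_sum -big_split/=; apply: eq_bigr => i _.
rewrite lnK; first by rewrite mulrCA divff ?mulr1// gt_eqF// p0.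
rewrite posrE divr_gt0 ?p0// /empirical.
rewrite divr_gt0 ?ltr0n ?(leq_ltn_trans _ (ltn_ord k))//.
by apply/card_gt0P; exists k; rewrite inE.
Qed.

(** The number of occurrences of each symbol in each sequence. *)
Definition type_of n (y : 'M[Y]_(n, M)) : {ffun 'I_M * Y -> 'I_n.+1} :=
  [ffun p => inord #|[pred k : 'I_n | y k p.1 == p.2]|].

Lemma empirical_type n (y : 'M[Y]_(n, M)) i a :
  empirical R y i a = (type_of y (i, a))%:R / n%:R :> R.
Proof.
rewrite ffunE inordK// ltnS /=.
by rewrite (leq_trans (max_card _))// card_ord.
Qed.

(** There are at most [(n + 1) ^ (M * #|Y|)] types, and for each of them the
    maximum likelihood fit is one fixed product law. *)
Lemma sum_max_likelihood n :
  \sum_(y : 'M[Y]_(n, M)) \prod_k \prod_i empirical R y i (y k i) <=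
  n.+1%:R ^+ (M * #|Y|) :> R.
Proof.
rewrite (partition_big (@type_of n) xpredT)//=.
rewrite (_ : _ ^+ _ = \sum_(c : {ffun 'I_M * Y -> 'I_n.+1}) 1); last first.
  by rewrite sumr_const -[RHS]mulr_natl mulr1 -natrX card_ffun card_prod !card_ord.
apply: ler_sum => c _.
have [[y0 /eqP cy]|none] := pselect (exists y0, type_of y0 == c); last first.
  by rewrite big_pred0// => y; apply/negP => yc; apply: none; exists y.
rewrite (@le_trans _ _ (\sum_(y : 'M[Y]_(n, M))
    \prod_k \prod_i ((c (i, y k i))%:R / n%:R)))//; last first.
  rewrite (sum_prod_mx (fun _ i a => (c (i, a))%:R / n%:R)).
  rewrite big1// => k _; rewrite big1// => i _.
  rewrite -[RHS](sum_empirical y0 i (leq_ltn_trans (leq0n _) (ltn_ord k))).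
  by apply: eq_bigr => a _; rewrite empirical_type cy.
rewrite [leRHS](bigID (fun y => type_of y == c))/= ler_wpDr//.
  apply: sumr_ge0 => y _; apply: prodr_ge0 => k _; apply: prodr_ge0 => i _.
  by rewrite divr_ge0.
apply: ler_sum => y /eqP yc; rewrite le_eqVlt; apply/orP; left; apply/eqP.
by apply: eq_bigr => k _; apply: eq_bigr => i _; rewrite empirical_type yc.
Qed.

(** Markov's inequality applied to the exponential of the divergence. *)
Lemma divergence_tail (p : 'I_M -> dist R Y) n (l : R) :
  (forall i, full_support (p i)) ->
  \sum_(y : 'M[Y]_(n, M) | l <= n%:R * divergence p y)
     \prod_k \prod_i p i (y k i) <=
  n.+1%:R ^+ (M * #|Y|) * expR (- l).
Proof.
move=> p0; rewrite expRN ler_pdivlMr ?expR_gt0// mulr_suml.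
have w0 (y : 'M[Y]_(n, M)) : 0 <= \prod_k \prod_i p i (y k i).
  by apply: prodr_ge0 => k _; apply: prodr_ge0 => i _; exact: dist_ge0.
apply: le_trans (sum_max_likelihood n).
under [leRHS]eq_bigr do rewrite -(expR_divergence _ p0).
rewrite [leRHS](bigID (fun y => l <= n%:R * divergence p y))/= ler_wpDr//.
  by apply: sumr_ge0 => y _; rewrite mulr_ge0// expR_ge0.
by apply: ler_sum => y ly; rewrite ler_wpM2l// ler_expR.
Qed.

End types.

(** * Observed events, error probability and expected stopping time *)

Lemma finite_valued_measurable d (T : measurableType d) (V : finType)
    (f : T -> V) : (forall v, measurable [set w | f w = v]) ->
  forall A : pred V, measurable [set w | A (f w)].
Proof.
move=> fm A; rewrite (_ : [set w | _] =
    \bigcup_(v in [set v | A v]) [set w | f w = v]).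
  by apply: fin_bigcup_measurable => //; exact: finite_finset.
by apply/seteqP; split=> w /= => [Aw|[v Av ->]//]; exists (f w).
Qed.

Lemma probability_finite_valued d (T : measurableType d) (R : realType)
    (P : probability T R) (V : finType) (f : T -> V) :
  (forall v, measurable [set w | f w = v]) ->
  forall A : pred V,
    (P [set w | A (f w)] <= \sum_(v | A v) P [set w | f w = v])%E.
Proof.
move=> fm A; rewrite -big_filter.
have -> : [set w | A (f w)] =
    [set w | f w \in [seq v <- index_enum V | A v]].
  by apply/seteqP; split=> w /=; rewrite mem_filter mem_index_enum andbT.
elim: [seq v <- _ | _] => [|v s Ps].
  rewrite (_ : [set w | _] = set0); last by apply/seteqP; split.
  by rewrite big_nil measure0.
have -> : [set w | f w \in v :: s] = [set w | f w = v] `|` [set w | f w \in s].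
  apply/seteqP; split=> w /=; rewrite inE.
    by case/orP => [/eqP ->|]; [left|right].
  by case=> [->|->]; rewrite ?eqxx ?orbT.
rewrite big_cons (le_trans (measureU2 _ _ _)) ?leeD2l//.
exact: (finite_valued_measurable fm (mem s)).
Qed.

Section model.
Variables (R : realType) (Y : finType) (M K : nat).
Variables (pi : dist R Y) (mu : 'I_M -> dist R Y) (m : obs_model K pi mu).

(** The law of each single sequence under the hypothesis [S]. *)
Definition marginal (S : hyp M K) (i : 'I_M) : dist R Y :=
  if i \in val S then mu i else pi.

Lemma joint_law_marginal (S : hyp M K) n (y : 'M[Y]_(n, M)) :
  joint_law pi mu S y = \prod_k \prod_i marginal S i (y k i).
Proof.
apply: eq_bigr => k _; rewrite [RHS](bigID (mem (val S)))/=.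
by congr (_ * _); apply: eq_bigr => i iS; rewrite /marginal ?iS ?(negbTE iS).
Qed.

Lemma marginal_full_support (S : hyp M K) :
  admissible pi mu -> forall i, full_support (marginal S i).
Proof. by move=> [pi0 mu0 _] i; rewrite /marginal; case: ifP. Qed.

Lemma sample_measurable n (A : pred 'M[Y]_(n, M)) :
  measurable [set w | A (sample (obs m) n w)].
Proof.
apply: (finite_valued_measurable (f := sample (obs m) n)) => y.
have -> : [set w | sample (obs m) n w = y] =
    \bigcap_(p in [set: 'I_n * 'I_M]) [set w | obs m p.2 p.1 w = y p.1 p.2].
  apply/seteqP; split=> w /=; first by move=> <- p _; rewrite /= mxE.
  by move=> h; apply/matrixP => k i; rewrite mxE; exact: (h (k, i)).
apply: fin_bigcap_measurable => [|[k i] _]; first exact: finite_finset.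
exact: obs_measurable.
Qed.

Lemma probability_divergence (S : hyp M K) n (l : R) : admissible pi mu ->
  (PS m S [set w |
    (l <= n%:R * divergence (marginal S) (sample (obs m) n w))%R]
   <= (n.+1%:R ^+ (M * #|Y|) * expR (- l))%:E)%E.
Proof.
move=> adm.
have fm (y : 'M[Y]_(n, M)) : measurable [set w | sample (obs m) n w = y].
  have := sample_measurable (pred1 y).
  by congr measurable; apply/seteqP; split=> w /= /eqP.
apply: (le_trans (probability_finite_valued (PS m S) fm
  (fun y => l <= n%:R * divergence (marginal S) y))).
under eq_bigr do rewrite obs_law joint_law_marginal.
rewrite sumEFin lee_fin; apply: divergence_tail.
exact: marginal_full_support.
Qed.

Section sequential.
Variable t : seq_test Y M K.

(** The stopping condition holds at time [n], whether or not it did before. *)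
Definition stopped n (w : Omega m) : bool := stops t (sample (obs m) n w).

(** The test stops at time [n]. *)
Definition first_stop n (w : Omega m) : Prop :=
  stopped n w /\ forall k, (k < n)%N -> ~~ stopped k w.

Lemma first_stop_ex n w : stopped n w ->
  exists2 k, (k <= n)%N & first_stop k w.
Proof.
move=> sn; have ex : exists n, stopped n w by exists n.
case: (ex_minnP ex) => k sk kmin; exists k; first exact: kmin.
split=> // j jk; apply/negP => /kmin; by rewrite leqNgt jk.
Qed.

Lemma stop_time_first n w : first_stop n w -> stop_time t w = n%:R%:E.
Proof.
move=> [sn nmin]; apply/eqP; rewrite eq_le; apply/andP; split.
  by apply: ereal_inf_lbound; exists n.
apply/ereal_infP => _ [k /= sk <-]; rewrite lee_fin ler_nat leqNgt.
by apply/negP => /nmin; rewrite /stopped sk.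
Qed.

Lemma stop_time_never w : (forall n, ~~ stopped n w) -> stop_time t w = +oo%E.
Proof.
move=> never; rewrite /stop_time (_ : [set _ | _ in _] = set0) ?ereal_inf0//.
by apply/seteqP; split=> // _ [n /= sn _]; have := never n; rewrite /stopped sn.
Qed.

Lemma stop_time_ge0 (w : Omega m) : (0 <= stop_time t w)%E.
Proof. by apply/ereal_infP => _ [n _ <-]; rewrite lee_fin. Qed.

Lemma stop_timeE w n : stop_time t w = n%:R%:E <-> first_stop n w.
Proof.
split; last exact: stop_time_first.
have [[k /first_stop_ex[j _ fj]]|never] := pselect (exists k, stopped k w).
  by rewrite (stop_time_first fj) => -[/eqP]; rewrite eqr_nat => /eqP <-.
rewrite stop_time_never// => k; apply/negP => sk; apply: never; by exists k.
Qed.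

Lemma error_event_measurable (S : hyp M K) :
  measurable (error_event (m := m) t S).
Proof.
apply: measurableC.
rewrite (_ : [set w | _] = \bigcup_n
    ([set w | (fun y => stops t y && (decide t y == S)) (sample (obs m) n w)]
     `&` \bigcap_(k in [set k | (k < n)%N]) [set w | ~~ stopped k w])).
  apply: bigcupT_measurable => n; apply: measurableI.
    exact: (@sample_measurable n (fun y => stops t y && (decide t y == S))).
  apply: bigcap_measurableType => k _.
  exact: (@sample_measurable k (fun y => ~~ stops t y)).
apply/seteqP; split=> w /=.
  move=> [n /stop_timeE[sn nmin] dn]; exists n => //; split=> /=.
    by apply/andP; split; [exact: sn|exact/eqP].
  exact: nmin.
move=> [n _ [/= /andP[sn /eqP dn] nmin]]; exists n => //.
by apply/stop_timeE.
Qed.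

(** An error is a wrong decision at some time, unless the test never stops. *)
Lemma probability_error_le (S : hyp M K) (u : nat -> R) (c : R) :
  (forall n, (PS m S [set w | stopped n w &&
      (decide t (sample (obs m) n w) != S)] <= (u n)%:E)%E) ->
  (forall n, \sum_(k < n) u k <= c) ->
  (forall e, 0 < e -> exists n, (PS m S [set w | ~~ stopped n w] <= e%:E)%E) ->
  (PS m S (error_event t S) <= c%:E)%E.
Proof.
move=> Pu uc never; apply/lee_addgt0Pr => e e0; have [n Pn] := never e e0.
pose W k := [set w | stopped k w && (decide t (sample (obs m) k w) != S)].
have Wm k : measurable (W k).
  exact: (@sample_measurable k (fun y => stops t y && (decide t y != S))).
have Nm : measurable [set w | ~~ stopped n w].
  exact: (@sample_measurable n (fun y => ~~ stops t y)).
have WSm : measurable (\big[setU/set0]_(k < n.+1) W k).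
  by apply: bigsetU_measurable.
apply: (@le_trans _ _ (PS m S (\big[setU/set0]_(k < n.+1) W k `|`
    [set w | ~~ stopped n w]))).
  apply: le_measure; rewrite ?inE//; [exact: error_event_measurable|
    exact: measurableU|].
  move=> w err; have [sn|sn] := boolP (stopped n w); last by right.
  left; have [k kn fk] := first_stop_ex sn.
  rewrite -bigcup_mkord; exists k => //=; rewrite /W/= fk.1/=.
  apply/eqP => dk; apply: err; exists k => //; exact/stop_timeE.
apply: (le_trans (measureU2 _ _ _)) => //; apply: leeD => //.
apply: (le_trans (Boole_inequality _ _)) => //.
apply: (@le_trans _ _ (\sum_(k < n.+1) (u k)%:E)%E); last first.
  by rewrite sumEFin lee_fin.
by apply: lee_sum => k _; exact: Pu.
Qed.

(** The stopping time is at most the number of times at which the stopping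
    condition fails. *)
Lemma expected_time_le (S : hyp M K) :
  (expected_time m t S <= \sum_(0 <= n <oo) PS m S [set w | ~~ stopped n w])%E.
Proof.
pose f n (w : Omega m) : \bar R := (\1_[set w | ~~ stopped n w] w)%:E.
have Nm n : measurable [set w | ~~ stopped n w].
  exact: (@sample_measurable n (fun y => ~~ stops t y)).
have f0 n w : (0 <= f n w)%E by rewrite lee_fin.
have stop_le w : (stop_time t w <= \sum_(0 <= n <oo) f n w)%E.
  have partial n : (forall k, (k < n)%N -> ~~ stopped k w) ->
      (n%:R%:E <= \sum_(0 <= n <oo) f n w)%E.
    move=> nmin; apply: le_trans (nneseries_lim_ge n _); last by [].
    rewrite big_mkord (eq_bigr (fun=> 1%:E)).
      by rewrite sumEFin lee_fin sumr_const card_ord.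
    by move=> k _; rewrite /f indicE mem_set//=; exact: nmin.
  have [[k /first_stop_ex[j _ fj]]|never] := pselect (exists k, stopped k w).
    by rewrite (stop_time_first fj); apply: partial; case: fj.
  rewrite (_ : (\sum_(0 <= n <oo) f n w = +oo)%E) ?leey//.
  apply/eqyP => A A0.
  apply: (@le_trans _ _ (Num.bound A)%:R%:E).
    by rewrite lee_fin ltW// archi_boundP// ltW.
  by apply: partial => k _; apply/negP => sk; apply: never; exists k.
rewrite /expected_time.
apply: (@le_trans _ _ (\int[PS m S]_w (\sum_(0 <= n <oo) f n w))%E); last first.
  rewrite integral_nneseries//; last first.
    move=> n; apply/measurable_realfun.measurable_EFinP.
    exact: measurable_realfun.measurable_indic.
  apply: lee_nneseries => n *; first by rewrite integral_ge0.
  by rewrite integral_indic// setIT.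
rewrite !ge0_integralTE; [|by move=> w; exact: nneseries_ge0|exact: stop_time_ge0].
apply: ereal_sup_le => _ [h hf <-]; exists h => // w.
exact: le_trans (hf w) (stop_le w).
Qed.

End sequential.
End model.

(** * Polynomial factors against exponentials *)

Lemma ln_le_linear (R : realType) (a : R) : 0 < a ->
  exists2 C, 0 <= C & forall n, ln n.+1%:R <= a * n%:R + C.
Proof.
move=> a0; exists (a + `|ln a|) => [|n]; first by rewrite addr_ge0// ltW.
have := @ln_sublinear R (a * n.+1%:R).
rewrite mulr_gt0// => /(_ isT); rewrite lnM ?posrE// -[n.+1%:R]natr1.
by have := ler_norm (- ln a); rewrite normrN; lra.
Qed.

Lemma expR_ln_natS (R : realType) (n : nat) : expR (ln n.+1%:R) = n.+1%:R :> R.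
Proof. by rewrite lnK// posrE. Qed.

Lemma poly_exp_le_geometric (R : realType) (d : nat) (eta : R) : 0 < eta ->
  exists a x : R, [/\ 0 <= a, 0 < x < 1 & forall n,
    n.+1%:R ^+ d * expR (- (n%:R * eta)) <= a * x ^+ n].
Proof.
move=> eta0; pose b := eta / 2 / d.+1%:R.
have b0 : 0 < b by rewrite !divr_gt0.
have [C _ hC] := ln_le_linear b0.
have db : d%:R * b <= eta / 2.
  have -> : eta / 2 = d.+1%:R * b by rewrite /b mulrCA divff ?mulr1.
  by rewrite ler_pM2r// ler_nat.
exists (expR (d%:R * C)), (expR (- (eta / 2))); split; first exact: expR_ge0.
  by rewrite expR_gt0 expR_lt1; lra.
move=> n; rewrite -{1}expR_ln_natS -!expRM_natl -!expRD ler_expR.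
have := ler_wpM2l (ler0n R d) (hC n); have := ler_wpM2l (ler0n R n) db.
by lra.
Qed.

(** * The outlier test *)

Section outlier.
Variables (R : realType) (Y : finType) (M K : nat).
Variables (pi : dist R Y) (mu : 'I_M -> dist R Y).
Hypothesis adm : admissible pi mu.

Let pi0 : full_support pi. Proof. by case: adm. Qed.
Let mu0 i : full_support (mu i). Proof. by case: adm. Qed.

(** A one-letter alphabet carries a single distribution. *)
Lemma card_alphabet_gt1 : (0 < M)%N -> (1 < #|Y|)%N.
Proof.
move=> M0; rewrite ltnNge; apply/negP => /fintype_le1P Y1.
have [_ _ /(_ (Ordinal M0)) /negP] := adm; apply.
have one (p : dist R Y) y : p y = 1.
  by rewrite -(sum_dist p) (bigD1 y)//= big1 ?addr0// => z; rewrite (Y1 y z) eqxx.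
by apply/eqP/val_inj/ffunP => y /=; rewrite !one.
Qed.

Lemma min_relent_finite (S : hyp M K) : (0 < K)%N ->
  exists D : R, [/\ 0 < D, min_relent pi mu S = D%:E &
    forall i, i \in val S -> D <= relent (mu i) pi].
Proof.
move=> K0; have /card_gt0P[i0 i0S] : (0 < #|val S|)%N by rewrite (eqP (valP S)).
have [|i iS minE] := @eq_bigmin _ _ _ +oo%E i0 (mem (val S))
  (fun i => (relent (mu i) pi)%:E) i0S.
  by move=> *; rewrite leey.
exists (relent (mu i) pi); split.
- by apply: relent_gt0 => //; case: adm.
- by rewrite /min_relent minE.
- by move=> j jS; rewrite -lee_fin -minE; exact: bigmin_le_cond.
Qed.

Lemma Gstat_ge0 n (y : 'M[Y]_(n, M)) (S : hyp M K) : 0 <= Gstat pi y S.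
Proof. by apply: sumr_ge0 => j _; exact: relent_empirical_ge0. Qed.

Lemma Gstat_le_divergence n (y : 'M[Y]_(n, M)) (S : hyp M K) :
  Gstat pi y S <= divergence (marginal pi mu S) y.
Proof.
rewrite /divergence (bigID (mem (val S)))/= ler_wpDl//.
  apply: sumr_ge0 => i _; apply: relent_empirical_ge0.
  exact: marginal_full_support.
by apply: ler_sum => j jS; rewrite /marginal (negbTE jS).
Qed.

(** If all the empirical distributions are close to the true laws, every wrong
    hypothesis [S'] has a statistic larger than that of [S], since the
    complement of [S'] contains a true outlier. *)
Lemma Gstat_gap (S : hyp M K) (D : R) :
  (forall i, i \in val S -> D <= relent (mu i) pi) ->
  forall e : R, 0 < e -> exists2 eta : R, 0 < eta &
    forall n (y : 'M[Y]_(n, M)), (0 < n)%N ->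
      divergence (marginal pi mu S) y <= eta ->
      forall S' : hyp M K, S' != S -> D - e <= Gstat pi y S' - Gstat pi y S.
Proof.
move=> minD e e0; have e20 : 0 < e / 2 by rewrite divr_gt0.
have /choice[h hP] : forall i, exists eta : R, 0 < eta /\
    forall g : Y -> R, (forall y, 0 <= g y) -> \sum_y g y = 1 ->
      relent g (mu i) <= eta -> relent (mu i) pi - e / 2 <= relent g pi.
  move=> i; have [eta eta0 etaP] := relent_lsc (mu0 i) pi0 e20.
  by exists eta.
exists (\big[Num.min/e / 2]_i h i).
  by apply: lt_bigmin => // i _; case: (hP i).
move=> n y n0 ydiv S' S'S.
have /subsetPn[i iS iS'] : ~~ (val S \subset val S').
  apply: contra S'S => SS'; rewrite eq_sym -val_eqE eqEcard SS'/=.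
  by rewrite (eqP (valP S)) (eqP (valP S')).
have term_le j : relent (empirical R y j) (marginal pi mu S j) <=
    \big[Num.min/e / 2]_i h i.
  apply: le_trans ydiv; rewrite /divergence (bigD1 j)//= ler_wpDr//.
  apply: sumr_ge0 => k _; apply: relent_empirical_ge0.
  exact: marginal_full_support.
have lo : D - e / 2 <= Gstat pi y S'.
  rewrite /Gstat (bigD1 i)//= ler_wpDr//.
    by apply: sumr_ge0 => j _; exact: relent_empirical_ge0.
  apply: (@le_trans _ _ (relent (mu i) pi - e / 2)); first by rewrite lerB// minD.
  apply: (hP i).2; [exact: empirical_ge0|exact: sum_empirical|].
  have := term_le i; rewrite /marginal iS => /le_trans; apply.
  exact: bigmin_le.
have hi : Gstat pi y S <= e / 2.
  apply: le_trans (Gstat_le_divergence y S) (le_trans ydiv _).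
  by apply/bigmin_leP; left.
by lra.
Qed.

Variable Shat : dist R Y -> forall n, 'M[Y]_(n, M) -> hyp M K.
Hypothesis Shat_argmin : argmin_rule Shat.
Variable m : obs_model K pi mu.

Let stop T n w := stopped (outlier_test Shat pi T) (m := m) n w.

(** The statistic of the decision being nonnegative, the test can stop on a
    wrong decision only if the statistic of [S], hence the divergence, is
    large. *)
Lemma wrong_divergence (S : hyp M K) (T : R) n w :
  stop T n w && (decide (outlier_test Shat pi T) (sample (obs m) n w) != S) ->
  threshold Y M T n <= n%:R * divergence (marginal pi mu S) (sample (obs m) n w).
Proof.
rewrite /stop /stopped /=; set y := sample _ _ _.
move=> /andP[/andP[n0 /bigmin_gtP[_ hS]] dS].
have := hS S; rewrite eq_sym => /(_ dS); rewrite lte_fin => /ltW /le_trans; apply.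
rewrite ler_wpM2l// (le_trans _ (Gstat_le_divergence _ _))//.
by rewrite gerBl Gstat_ge0.
Qed.

(** When the threshold is below [n * (D - e)], the test fails to stop at time
    [n] only if the divergence is bounded away from zero. *)
Lemma not_stopped_probability (S : hyp M K) (D e : R) : 0 < e -> e < D ->
  (forall i, i \in val S -> D <= relent (mu i) pi) ->
  exists2 eta : R, 0 < eta & forall T n, (0 < n)%N ->
    threshold Y M T n < n%:R * (D - e) ->
    (PS m S [set w | ~~ stop T n w] <=
      (n.+1%:R ^+ (M * #|Y|) * expR (- (n%:R * eta)))%:E)%E.
Proof.
move=> e0 eD minD; have [eta eta0 gap] := Gstat_gap minD e0.
exists eta => // T n n0 thr.
apply: le_trans (probability_divergence m S n (n%:R * eta) adm).
apply: le_measure; rewrite ?inE.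
- exact: (@sample_measurable _ _ _ _ _ _ _ _
    (fun y => ~~ stops (outlier_test Shat pi T) y)).
- exact: (@sample_measurable _ _ _ _ _ _ _ _
    (fun y => n%:R * eta <= n%:R * divergence (marginal pi mu S) y)).
move=> w /=; apply: contraNT; rewrite -ltNge ltr_pM2l ?ltr0n// => /ltW.
rewrite /stop /stopped /=; set y := sample _ _ _ => /(gap _ _ n0) gapy.
have ShatE : Shat pi y = S.
  apply/eqP/negPn/negP => /gapy; have := Shat_argmin pi0 y S; lra.
rewrite n0 ShatE; apply/bigmin_gtP; split=> [|S' /gapy h]; first by rewrite ltry.
by rewrite lte_fin (lt_le_trans thr)// ler_wpM2l.
Qed.

(** The threshold is [ln T] plus a sublinear function of the time, hence it is
    exceeded by [n * (D - e)] from about time [ln T / (D - 2 * e)] on. *)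
Lemma threshold_lt (D e : R) : 0 < e -> 2 * e < D ->
  exists C : R, forall T, exists n0 : nat,
    n0%:R <= Num.max (ln T) 0 / (D - 2 * e) + C /\
    forall n, (n0 <= n)%N -> (0 < n)%N /\ threshold Y M T n < n%:R * (D - e).
Proof.
move=> e0 eD; have De0 : 0 < D - 2 * e by lra.
set c : R := ((M + 1) * #|Y|)%N%:R.
have c0 : 0 <= c by exact: ler0n.
have [|C C0 hC] := @ln_le_linear R (e / (c + 1)); first by rewrite divr_gt0//; lra.
have ce : c * (e / (c + 1)) <= e.
  rewrite mulrA ler_pdivrMr; last lra.
  by rewrite mulrC ler_wpM2l//; lra.
exists (c * C / (D - 2 * e) + 1) => T; set L := Num.max (ln T) 0.
have L0 : 0 <= L by rewrite le_max lexx orbT.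
have LT : ln T <= L by rewrite le_max lexx.
pose q := (L + c * C) / (D - 2 * e).
have q0 : 0 <= q.
  by apply: divr_ge0; [apply: addr_ge0 => //; exact: mulr_ge0|exact: ltW].
have /andP[q1 q2] := truncn_itv q0.
exists (Num.trunc q).+1; split.
  by move: q1; rewrite -natr1 /q mulrDl; lra.
move=> n qn; have n0 : (0 < n)%N by exact: leq_trans qn.
split=> //; have : q < n%:R by rewrite (lt_le_trans q2)// ler_nat.
rewrite ltr_pdivrMr// => qn'; rewrite /threshold -/c addn1.
have := ler_wpM2l c0 (hC n); have := ler_wpM2l (ler0n R n) ce.
by lra.
Qed.

(** With [Num.max (ln T) 0] in place of [ln T], the bound is uniform in [T],
    including the values below 1. *)
Lemma expected_time_outlier_le (S : hyp M K) (D : R) : 0 < D ->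
  (forall i, i \in val S -> D <= relent (mu i) pi) ->
  forall e : R, 0 < e -> exists C : R, forall T,
    (expected_time m (outlier_test Shat pi T) S <=
      ((1 + e) * (Num.max (ln T) 0 / D) + C)%:E)%E.
Proof.
move=> D0 minD e e0.
(* chosen so that D - 2 * f = D / (1 + e) *)
pose f := (D - D / (1 + e)) / 2.
have De : D / (1 + e) < D by rewrite ltr_pdivrMr; [nra|lra].
have De0 : 0 < D / (1 + e) by rewrite divr_gt0//; lra.
have f0 : 0 < f by rewrite /f; lra.
have fD : D - 2 * f = D / (1 + e) by rewrite /f; lra.
have [eta eta0 tail] : exists2 eta : R, 0 < eta & forall T n, (0 < n)%N ->
    threshold Y M T n < n%:R * (D - f) ->
    (PS m S [set w | ~~ stop T n w] <=
      (n.+1%:R ^+ (M * #|Y|) * expR (- (n%:R * eta)))%:E)%E.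
  by apply: not_stopped_probability minD => //; lra.
have [a [x [a0 /andP[x0 x1] geo]]] := poly_exp_le_geometric (M * #|Y|) eta0.
have [|C hC] := @threshold_lt D f f0; first lra.
exists (C + a / (1 - x)) => T; have [n0 [n0L n0P]] := hC T.
apply: (le_trans (expected_time_le _ _ _)).
have Pge0 n : (0 <= PS m S [set w | ~~ stop T n w])%E by exact: measure_ge0.
apply: lime_le; first by apply: is_cvg_nneseries => *; exact: Pge0.
apply: nearW => N; rewrite big_mkord.
(* before time n0 the probability is bounded by 1 *)
pose v n := (n < n0)%N%:R + a * x ^+ n.
apply: (@le_trans _ _ (\sum_(n < N) (v n)%:E)%E).
  apply: lee_sum => n _; have [nn0|nn0] := ltnP n n0.
    apply: (le_trans (probability_le1 _ _)).
      exact: (@sample_measurable _ _ _ _ _ _ _ _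
        (fun y => ~~ stops (outlier_test Shat pi T) y)).
    by rewrite lee_fin /v nn0 lerDl mulr_ge0// exprn_ge0// ltW.
  have [np nthr] := n0P n nn0; apply: (le_trans (tail T n np nthr)).
  by rewrite lee_fin (le_trans (geo n))// /v ltnNge nn0 add0r.
rewrite sumEFin lee_fin big_split/=.
have h1 : \sum_(n < N) (n < n0)%N%:R <= n0%:R :> R.
  rewrite -natr_sum ler_nat (_ : (\sum_(n < N) (n < n0))%N = minn N n0) ?geq_minr//.
  elim: N => [|N IH]; first by rewrite big_ord0 min0n.
  by rewrite big_ord_recr/= IH; lia.
have h2 : \sum_(n < N) a * x ^+ n <= a / (1 - x).
  have := geometric_le_lim N a0 x0; rewrite gtr0_norm// => /(_ x1).
  by rewrite /series/= big_mkord.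
have h3 : Num.max (ln T) 0 / (D - 2 * f) = (1 + e) * (Num.max (ln T) 0 / D).
  by rewrite fD invf_div; ring.
by lra.
Qed.

(** The union bound over the time of a wrong decision telescopes, because the
    threshold beats the number of types by a factor [(n + 1) ^ #|Y|]. *)
Lemma probability_error_outlier (S : hyp M K) (T : R) : (0 < K)%N -> (0 < M)%N ->
  0 < T -> (PS m S (error_event (outlier_test Shat pi T) S) <= (T^-1)%:E)%E.
Proof.
move=> K0 M0 T0; have Y1 := card_alphabet_gt1 M0.
(* the test never stops at time 0 *)
pose u n : R := T^-1 * (if n is k.+1 then k.+1%:R^-1 - k.+2%:R^-1 else 0).
apply: (probability_error_le (u := u)).
- move=> n; apply: (@le_trans _ _ (PS m S [set w | (0 < n)%N &&
    (threshold Y M T n <=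
     n%:R * divergence (marginal pi mu S) (sample (obs m) n w))%R])).
    apply: le_measure; rewrite ?inE.
    + exact: (@sample_measurable _ _ _ _ _ _ _ _
        (fun y => stops (outlier_test Shat pi T) y &&
          (decide (outlier_test Shat pi T) y != S))).
    + exact: (@sample_measurable _ _ _ _ _ _ _ _
        (fun y => (0 < n)%N && (threshold Y M T n <=
           n%:R * divergence (marginal pi mu S) y))).
    move=> w /= h; rewrite (wrong_divergence h) andbT.
    by case/andP: h => /andP[].
  case: n => [|n].
    rewrite (_ : [set w | _] = set0); last by apply/seteqP; split.
    by rewrite measure0 lee_fin /u mulr0.
  apply: (le_trans (probability_divergence m S n.+1 _ adm)).
  have thrE : expR (threshold Y M T n.+1) =
      T * (n.+2%:R ^+ (M * #|Y|) * n.+2%:R ^+ #|Y|).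
    by rewrite /threshold !addn1 expRD lnK ?posrE// expRM_natl expR_ln_natS
      mulSnr exprD.
  rewrite lee_fin expRN thrE /u.
  set A := n.+2%:R ^+ (M * #|Y|); have A0 : A != 0 by rewrite expf_neq0.
  rewrite !invfM mulrCA [A * _]mulrA divff// mul1r ler_pM2l ?invr_gt0//.
  apply: (@le_trans _ _ (n.+2%:R ^- 2)).
    by rewrite lef_pV2 ?posrE ?exprn_gt0// ler_weXn2l// ler1n.
  have -> : n.+1%:R^-1 - n.+2%:R^-1 = (n.+1%:R * n.+2%:R)^-1 :> R.
    rewrite -!natr1; field; have := ler0n R n => n_ge0.
    by apply/andP; split; apply: lt0r_neq0; lra.
  by rewrite expr2 lef_pV2 ?posrE ?mulr_gt0// ler_pM2r// ler_nat.
- move=> n; apply: (@le_trans _ _ (T^-1 * (1 - n.+1%:R^-1))); last first.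
    by rewrite ler_piMr ?invr_ge0 1?ltW// gerBl invr_ge0.
  have uE k : \sum_(i < k.+1) u i = T^-1 * (1 - k.+1%:R^-1).
    elim: k => [|k IH]; first by rewrite big_ord1 /u invr1 subrr.
    by rewrite big_ord_recr/= IH /u; ring.
  rewrite -uE big_ord_recr/= lerDl; apply: mulr_ge0.
    by rewrite invr_ge0 ltW.
  by case: n => // n; rewrite subr_ge0 lef_pV2 ?posrE// ler_nat.
- move=> e e0; have [D [D0 _ minD]] := min_relent_finite S K0.
  have f0 : 0 < D / 4 by rewrite divr_gt0.
  have [eta eta0 tail] : exists2 eta : R, 0 < eta & forall T n, (0 < n)%N ->
      threshold Y M T n < n%:R * (D - D / 4) ->
      (PS m S [set w | ~~ stop T n w] <=
        (n.+1%:R ^+ (M * #|Y|) * expR (- (n%:R * eta)))%:E)%E.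
    by apply: not_stopped_probability minD => //; lra.
  have [a [x [a0 /andP[x0 x1] geo]]] := poly_exp_le_geometric (M * #|Y|) eta0.
  have [|C /(_ T)[n0 [_ n0P]]] := @threshold_lt D (D / 4) f0; first lra.
  have : geometric a x n @[n --> \oo] --> (0 : R).
    by apply: cvg_geometric; rewrite gtr0_norm.
  move=> /cvgrPdist_le/(_ e e0)[N _ hN]; exists (maxn N n0).
  have [np nthr] := n0P _ (leq_maxr N n0).
  apply: (le_trans (tail T _ np nthr)); rewrite lee_fin (le_trans (geo _))//.
  have := hN (maxn N n0) (leq_maxl _ _).
  by rewrite /= sub0r normrN; apply: le_trans; exact: ler_norm.
Qed.

Lemma Pmax_outlier_le (T : R) : (0 < K)%N -> (0 < M)%N ->
  0 < T -> (Pmax m (outlier_test Shat pi T) <= (T^-1)%:E)%E.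
Proof.
move=> K0 M0 T0; apply/bigmax_leP; split; first by rewrite lee_fin invr_ge0 ltW.
by move=> S _; exact: probability_error_outlier.
Qed.

Lemma Pmax_ge0 (t : seq_test Y M K) : (0 <= Pmax m t)%E.
Proof. exact: bigmax_ge_id. Qed.

Lemma Pmax_le1 (t : seq_test Y M K) : (Pmax m t <= 1)%E.
Proof.
apply/bigmax_leP; split=> // S _; apply: probability_le1.
exact: error_event_measurable.
Qed.

End outlier.

(** * Asymptotics *)

(** A bound up to a factor [1 + e] and an additive constant, for every
    positive [e], is an asymptotic bound once the right-hand side diverges. *)
Lemma asymp_le_of_affine (R : realType) (F : set_system R) (FF : Filter F)
    (a b : R -> \bar R) :
  (forall x, (0 <= a x)%E) ->
  (forall e : R, 0 < e -> exists C : R,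
     \forall x \near F, (a x <= (1 + e)%:E * b x + C%:E)%E) ->
  (forall A : R, \forall x \near F, (A%:E <= b x)%E) ->
  asymp_le F a b.
Proof.
move=> a0 ab bdiv.
pose r x := if b x \is a fin_num
  then Num.max 0 (fine (a x) / fine (b x) - 1) else 0.
exists r; split; last first.
  (* the case e = 1 of the hypothesis shows that a x is finite when b x is *)
  have [C abC] := ab 1 ltr01.
  near=> x.
  have b1 : (1%:E <= b x)%E by near: x; exact: bdiv.
  have : (a x <= (1 + 1)%:E * b x + C%:E)%E by near: x.
  move: b1 (a0 x); rewrite /r; case: (b x) => [t| |]//=; last first.
    by move=> _ _ _; rewrite addr0 mule1 leey.
  rewrite lee_fin; case: (a x) => [s| |]//= t1 s0 _.
  have t0 : 0 < t by lra.
  rewrite lee_fin.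
  have : s / t - 1 <= Num.max 0 (s / t - 1) by rewrite le_max lexx orbT.
  have sE : s = t * (s / t) by rewrite mulrCA divff ?mulr1// gt_eqF.
  by move=> h; rewrite {1}sE ler_pM2l//; lra.
apply/cvgrPdist_le => e e0.
have [C abC] : exists C : R,
    \forall x \near F, (a x <= (1 + e / 2)%:E * b x + C%:E)%E.
  by apply: ab; rewrite divr_gt0.
near=> x.
have b1 : (1%:E <= b x)%E by near: x; exact: bdiv.
have b2 : ((2 * `|C| / e)%:E <= b x)%E by near: x; exact: bdiv.
have : (a x <= (1 + e / 2)%:E * b x + C%:E)%E by near: x.
rewrite sub0r normrN; move: b1 b2 (a0 x); rewrite /r.
case: (b x) => [t| |]//=; last by rewrite normr0 => *; exact: ltW.
rewrite !lee_fin; case: (a x) => [s| |]//= t1 tC s0.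
rewrite lee_fin => st; have t0 : 0 < t by lra.
rewrite ger0_norm ?le_max ?lexx// ge_max ltW//= lerBlDr ler_pdivrMr//.
by move: tC; rewrite ler_pdivrMr// => tC; have := ler_norm C; lra.
Unshelve. all: by end_near. Qed.

Lemma err_to0_filter (R : realType) (perr : R -> \bar R) :
  Filter (err_to0 perr).
Proof.
apply: filter_from_filter; first by exists 1 => /=.
move=> i j /= i0 j0; exists (Num.min i j); first by rewrite /= lt_min i0.
move=> T /= [T0 h]; split; split=> //; apply: lt_le_trans h _;
  by rewrite lee_fin ge_min lexx ?orbT.
Qed.

Lemma lne_ge (R : realType) (p : \bar R) (A : R) :
  (0 <= p)%E -> (p <= (expR (- A))%:E)%E -> (A%:E <= - lne p)%E.
Proof.
case: p => [p| |]//; rewrite !lee_fin => p0 pA.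
have [p00|pn0] := eqVneq p 0.
  by rewrite p00 (_ : lne _ = -oo%E) ?leey// le0_lneNy.
have pp : 0 < p by rewrite lt_def pn0.
by rewrite lne_EFin// lee_fin lerNr -ler_expR lnK// posrE.
Qed.

Section outlier_asymptotics.
Variables (R : realType) (Y : finType) (M K : nat).
Hypotheses (M0 : (0 < M)%N) (K0 : (0 < K)%N).
Variables (pi : dist R Y) (mu : 'I_M -> dist R Y).
Hypothesis adm : admissible pi mu.
Variable Shat : dist R Y -> forall n, 'M[Y]_(n, M) -> hyp M K.
Hypothesis Shat_argmin : argmin_rule Shat.
Variable m : obs_model K pi mu.

Let perr T := Pmax m (outlier_test Shat pi T).

Lemma Pmax_outlier_cvg : perr T @[T --> +oo] --> 0%E.
Proof.
have inv0 : (T^-1)%:E @[T --> +oo] --> (0 : R)%:E.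
  apply: cvg_EFin; first by apply: nearW.
  by apply/gtr0_cvgV0; [exact: nbhs_pinfty_gt|exact: cvg_id].
apply: (squeeze_cvge _ (cvg_cst 0%E) inv0).
near=> T; rewrite Pmax_ge0/= Pmax_outlier_le//.
Unshelve. all: by end_near. Qed.

Lemma log_Pmax_ge (T : R) : 0 < T ->
  ((Num.max (ln T) 0)%:E <= - lne (perr T))%E.
Proof.
move=> T0; apply: lne_ge; first exact: Pmax_ge0.
rewrite /Num.max; case: ltP => _.
  by rewrite oppr0 expR0; exact: Pmax_le1.
by rewrite expRN lnK ?posrE//; exact: Pmax_outlier_le.
Qed.

(** The common source of the two asymptotic statements, which differ only in
    the filter. *)
Lemma asymp_expected_time (S : hyp M K) (D : R) (F : set_system R) :
  Filter F -> 0 < D -> (forall i, i \in val S -> D <= relent (mu i) pi) ->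
  (\forall T \near F, 0 < T) ->
  (forall A : R, \forall T \near F, (A%:E <= - lne (perr T))%E) ->
  asymp_le F (fun T => expected_time m (outlier_test Shat pi T) S)
    (fun T => (- lne (perr T) / D%:E)%E).
Proof.
move=> FF D0 minD Fpos Fdiv; have D0n : D != 0 by rewrite gt_eqF.
apply: asymp_le_of_affine.
- move=> T; apply: integral_ge0 => w _; exact: stop_time_ge0.
- move=> e e0; have [C hC] := expected_time_outlier_le adm Shat_argmin m D0 minD e0.
  exists C; near=> T.
  have T0 : 0 < T by near: T.
  apply: (le_trans (hC T)); rewrite EFinD leeD2r// inver (negbTE D0n).
  move: (log_Pmax_ge T0); case: (- lne _)%E => [x| |]//.
    rewrite lee_fin => Lx; rewrite lee_fin ler_wpM2l//; first lra.
    by rewrite ler_wpM2r// invr_ge0 ltW.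
  by rewrite gt0_mulye ?lte_fin ?invr_gt0// gt0_muley ?leey// lte_fin; lra.
- move=> A; near=> T.
  have : ((A * D)%:E <= - lne (perr T))%E by near: T.
  rewrite inver (negbTE D0n); case: (- lne _)%E => [x| |]//.
    by rewrite !lee_fin ler_pdivlMr.
  by rewrite gt0_mulye ?leey// lte_fin invr_gt0.
Unshelve. all: by end_near. Qed.

End outlier_asymptotics.

Theorem theorem4 (R : realType) (Y : finType) (M K : nat)
    (hM : (3 <= M)%N) (hK : (2 < K)%N) (hKM : (2 * K < M)%N) :
  (forall Shat : dist R Y -> forall n, 'M[Y]_(n, M) -> hyp M K,
     argmin_rule Shat -> univ_exp_consistent (outlier_test Shat)) /\
  (forall (pi : dist R Y) (mu : 'I_M -> dist R Y), admissible pi mu ->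
     (exists C : R,
        forall Shat : dist R Y -> forall n, 'M[Y]_(n, M) -> hyp M K,
        argmin_rule Shat ->
        forall (m : obs_model K pi mu) (T : R), 0 < T ->
          (Pmax m (outlier_test Shat pi T) <= (C / T)%:E)%E) /\
     (forall Shat : dist R Y -> forall n, 'M[Y]_(n, M) -> hyp M K,
        argmin_rule Shat ->
        forall (m : obs_model K pi mu) (S : hyp M K),
          asymp_le (pinfty_nbhs R)
            (fun T => expected_time m (outlier_test Shat pi T) S)
            (fun T => (- lne (Pmax m (outlier_test Shat pi T))
                       / min_relent pi mu S)%E))).
Proof.
have M0 : (0 < M)%N by exact: leq_trans hM.
have K0 : (0 < K)%N by exact: leq_trans hK.
split=> [Shat hS pi mu adm m perr|pi mu adm].
  split; first exact: Pmax_outlier_cvg.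
  move=> S; have [D [D0 _ minD]] := min_relent_finite adm S K0.
  exists D => //; apply: asymp_expected_time => //.
  - exact: err_to0_filter.
  - by exists 1 => [|T []//]; exact: ltr01.
  move=> A; exists (expR (- A)) => [|T [T0 pT]]; first exact: expR_gt0.
  by apply: lne_ge; [exact: Pmax_ge0|exact: ltW].
split; first by exists 1 => Shat hS m T T0; rewrite div1r; exact: Pmax_outlier_le.
move=> Shat hS m S; have [D [D0 -> minD]] := min_relent_finite adm S K0.
apply: asymp_expected_time => //; first exact: nbhs_pinfty_gt.
move=> A; near=> T; have T0 : 0 < T by near: T; exact: nbhs_pinfty_gt.
apply: le_trans (log_Pmax_ge M0 K0 adm hS m T0).
rewrite lee_fin le_max -ler_expR lnK ?posrE//; apply/orP; left.
by near: T; exact: nbhs_pinfty_ge.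
Unshelve. all: by end_near. Qed.
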